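(* For every $n\in\mathbb{N}$, the graph $G(3,n)$ is connected and has diameter at most $3$.
   Context: For a prime $p$ and $n\in\mathbb{N}$, $G(p,n)$ is the simple graph with vertex set $\{2,4,\ldots,2n\}$ in which two distinct vertices $a,b$ are adjacent if and only if both $\frac{a+b}{2}$ and $\frac{|a-b|}{2}$ are odd positive integers neither of which equals $pk$ for an integer $k\ge 2$. *)

(* Defs.v *)
From mathcomp Require Import all_boot all_order all_algebra.
Set Implicit Arguments.
Unset Strict Implicit.
Unset Printing Implicit Defensive.

Record sgraph := SGraph {
  vertex :> finType;
  adj : rel vertex;
  adj_sym : symmetric adj;
  adj_irr : irreflexive adj
}.

Definition has_walk (G : sgraph) (k : nat) (x y : G) : bool :=
  [exists w : k.-tuple G, path (@adj G) x w && (last x w == y)].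

(* A shortest walk has fewer than #|G| edges, so the value #|G|, returned when
   y is not reachable from x, stands for an infinite distance. *)
Definition dist (G : sgraph) (x y : G) : nat :=
  find (fun k => has_walk k x y) (iota 0 #|G|).

Definition diameter (G : sgraph) : nat := \max_(x : G) \max_(y : G) dist x y.

Definition connected (G : sgraph) : Prop :=
  0 < #|G| /\ forall x y : G, connect (@adj G) x y.

Definition Gvertex (n : nat) : finType :=
  {a : 'I_(2 * n).+1 | (0 < a) && ~~ odd a}.

Definition label (n : nat) (a : Gvertex n) : nat := val (val a).

(* Being odd, m is positive.  For p > 0, any k with m = p * k satisfies
   k <= m, so bounding k loses nothing. *)
Definition admissible (p m : nat) : bool :=
  odd m && ~~ [exists k : 'I_m.+1, (2 <= k) && (m == p * k)].

(* Labels are even, so both halvings are exact. *)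
Definition Gadj (p n : nat) : rel (Gvertex n) := fun a b =>
  [&& a != b,
      admissible p (label a + label b)./2 &
      admissible p `|((label a)%:Z - (label b)%:Z)%R|%N./2].

Lemma Gadj_sym (p n : nat) : symmetric (@Gadj p n).
Proof. by move=> a b; rewrite /Gadj eq_sym addnC distnC. Qed.

Lemma Gadj_irr (p n : nat) : irreflexive (@Gadj p n).
Proof. by move=> a; rewrite /Gadj eqxx. Qed.

Definition G (p n : nat) : sgraph := SGraph (@Gadj_sym p n) (@Gadj_irr p n).

(* Main.v *)
Require Import Defs.
From mathcomp Require Import all_boot all_order all_algebra.
From mathcomp Require Import zify.
Set Implicit Arguments.
Unset Strict Implicit.
Unset Printing Implicit Defensive.

(** Halve the labels, so that the vertices are 1, ..., n.  A multiple of 3 and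
    a non-multiple of 3 are adjacent as soon as their parities differ, and every
    non-multiple of 3 has a neighbour of the same kind: i and i + 3 are
    adjacent, and so are 1 and 2.  Walks of length at most 3 are then obtained
    by passing through 1, 2, 3 or 6, whichever has the right parity. *)

(** Among the odd multiples of 3 only 3 itself survives: the factor 0 would make [m] even, and every
    other factor except 1 is at least 2. *)
Lemma admissible3E (m : nat) :
  admissible 3 m = odd m && ((m == 3) || ~~ (3 %| m)).
Proof.
rewrite /admissible; case: (boolP (odd m)) => //= om.
apply/idP/idP => [|mP].
- apply: contraR; rewrite negb_or negbK => /andP[m_neq3 /dvdnP[k mE]].
  have k_lt : k < m.+1 by lia.
  by apply/existsP; exists (Ordinal k_lt) => /=; lia.
- by apply/existsP => -[k /=]; lia.
Qed.

(** Since [i + j] and [|i - j|] have the same parity, one oddness test serves both and also forces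
    [i] and [j] to differ. The last disjunction says that [|i - j|] is 3 or prime to 3, without
    truncated subtraction. *)
Definition half_adj : rel nat := fun i j =>
  [&& odd (i + j), (i + j == 3) || ~~ (3 %| i + j) &
      [|| i + 3 == j, j + 3 == i | i %% 3 != j %% 3]].

Lemma half_adjC (i j : nat) : half_adj i j = half_adj j i.
Proof. rewrite /half_adj; lia. Qed.

Lemma half_adj_dvd (i c : nat) :
  ~~ (3 %| i) -> 3 %| c -> odd (i + c) -> half_adj i c.
Proof. rewrite /half_adj; lia. Qed.

Lemma half_adj_nondvd_ex (n i : nat) : 1 < n -> 0 < i <= n -> ~~ (3 %| i) ->
  exists2 j, half_adj i j & [&& 0 < j <= n, ~~ (3 %| j) & odd (i + j)].
Proof.
move=> n_gt1 i_n i3; have [->|i1] := eqVneq i 1; first by exists 2 => //; lia.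
have [->|i2] := eqVneq i 2; first by exists 1 => //; lia.
(* Here [i >= 4]; moving down by 3 stays within the range, and the sum [2 * i - 3] is odd and prime
   to 3. *)
by exists (i - 3); rewrite /half_adj; lia.
Qed.

Definition short_walk (n i j : nat) : Prop :=
  exists w : seq nat, [/\ size w <= 3, all (fun k => 0 < k <= n) w,
    path half_adj i w & last i w = j].

Section ShortWalks.
Variable n : nat.

Lemma short_walk0 i : short_walk n i i.
Proof. by exists [::]. Qed.

Lemma short_walk1 i j : 0 < j <= n -> half_adj i j -> short_walk n i j.
Proof. by move=> jn ij; exists [:: j]; split=> //=; rewrite ?jn ?ij. Qed.

Lemma short_walk2 i k j : 0 < k <= n -> 0 < j <= n ->
  half_adj i k -> half_adj k j -> short_walk n i j.
Proof.
by move=> kn jn ik kj; exists [:: k; j]; split=> //=; rewrite ?kn ?jn ?ik ?kj.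
Qed.

Lemma short_walk3 i k l j : 0 < k <= n -> 0 < l <= n -> 0 < j <= n ->
  half_adj i k -> half_adj k l -> half_adj l j -> short_walk n i j.
Proof.
move=> kn ln jn ik kl lj; exists [:: k; l; j].
by split=> //=; rewrite ?kn ?ln ?jn ?ik ?kl ?lj.
Qed.

Lemma short_walk_dvd_dvd i j : 0 < i <= n -> 0 < j <= n ->
  3 %| i -> 3 %| j -> short_walk n i j.
Proof.
move=> i_n j_n i3 j3.
(* A positive multiple of 3 gives [n >= 3], so 1 and 2 are available. Each end is joined to the one
   of opposite parity, and the edge between 1 and 2 is used when these differ. *)
have [oi|ei] := boolP (odd i); have [oj|ej] := boolP (odd j).
- by apply: (@short_walk2 _ 2); rewrite /half_adj; lia.
- by apply: (@short_walk3 _ 2 1); rewrite /half_adj; lia.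
- by apply: (@short_walk3 _ 1 2); rewrite /half_adj; lia.
- by apply: (@short_walk2 _ 1); rewrite /half_adj; lia.
Qed.

(** When the parities agree, a first step to another non-multiple of 3 flips the parity and leaves
    one edge to [j]. *)
Lemma short_walk_nondvd_dvd i j : 0 < i <= n -> 0 < j <= n ->
  ~~ (3 %| i) -> 3 %| j -> short_walk n i j.
Proof.
move=> i_n j_n i3 j3; have [oij|eij] := boolP (odd (i + j)).
  by apply: short_walk1 => //; apply: half_adj_dvd.
have [|k ik /and3P[kn k3 oik]] := @half_adj_nondvd_ex n i _ i_n i3; first lia.
by apply: (short_walk2 kn j_n ik); apply: half_adj_dvd => //; lia.
Qed.

Lemma short_walk_dvd_nondvd i j : 0 < i <= n -> 0 < j <= n ->
  3 %| i -> ~~ (3 %| j) -> short_walk n i j.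
Proof.
move=> i_n j_n i3 j3; have [oij|eij] := boolP (odd (j + i)).
  by apply: short_walk1 => //; rewrite half_adjC; apply: half_adj_dvd.
have [|k jk /and3P[kn k3 ojk]] := @half_adj_nondvd_ex n j _ j_n j3; first lia.
apply: (@short_walk2 _ k) => //; rewrite half_adjC //.
by apply: half_adj_dvd => //; lia.
Qed.

Lemma short_walk_nondvd_nondvd i j : 0 < i <= n -> 0 < j <= n ->
  ~~ (3 %| i) -> ~~ (3 %| j) -> short_walk n i j.
Proof.
move=> i_n j_n i3 j3; have [<-|ij] := eqVneq i j; first exact: short_walk0.
have [n_le2|n_gt2] := leqP n 2.
  by apply: short_walk1 => //; rewrite /half_adj; lia.
have n_gt1 := ltnW n_gt2.
have [k ik /and3P[kn k3 oik]] := half_adj_nondvd_ex n_gt1 i_n i3.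
have [l jl /and3P[ln l3 ojl]] := half_adj_nondvd_ex n_gt1 j_n j3.
have [oi|ei] := boolP (odd i); have [oj|ej] := boolP (odd j).
(* The natural midpoint 6 needs [n >= 6]. For smaller [n] the distinct ends can only be 1 and 5,
   both adjacent to 2. *)
- have [n_le5|n_gt5] := leqP n 5.
    by apply: (@short_walk2 _ 2); rewrite /half_adj; lia.
  by apply: (@short_walk2 _ 6); rewrite /half_adj; lia.
(* The odd end first moves to its even neighbour, so that 3, rather than 6, is the midpoint and
   [n >= 3] suffices. *)
- by apply: (@short_walk3 _ k 3) => //; rewrite /half_adj; lia.
- by apply: (@short_walk3 _ 3 l) => //; rewrite ?[half_adj l _]half_adjC //;
    rewrite /half_adj; lia.
- by apply: (@short_walk2 _ 3); rewrite /half_adj; lia.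
Qed.

Lemma short_walk_total i j : 0 < i <= n -> 0 < j <= n -> short_walk n i j.
Proof.
move=> i_n j_n; have [i3|i3] := boolP (3 %| i);
  have [j3|j3] := boolP (3 %| j).
- exact: short_walk_dvd_dvd.
- exact: short_walk_dvd_nondvd.
- exact: short_walk_nondvd_dvd.
- exact: short_walk_nondvd_nondvd.
Qed.

End ShortWalks.

Definition half_label (n : nat) (x : Gvertex n) : nat := (label x)./2.

Lemma labelE (n : nat) (x : Gvertex n) : label x = 2 * half_label x.
Proof. by case/andP: (valP x) => _; rewrite /half_label /label; lia. Qed.

Lemma half_label_range (n : nat) (x : Gvertex n) : 0 < half_label x <= n.
Proof.
have x_lt : label x < (2 * n).+1 := ltn_ord (val x).
have x_gt0 : 0 < label x by case/andP: (valP x).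
by have := labelE x; lia.
Qed.

Lemma half_label_inj (n : nat) : injective (@half_label n).
Proof.
by move=> x y xy; do 2!apply: val_inj; have := labelE x; rewrite xy -labelE.
Qed.

Lemma half_label_surj (n i : nat) :
  0 < i <= n -> exists x : Gvertex n, half_label x = i.
Proof.
move=> i_n; have i_lt : 2 * i < (2 * n).+1 by lia.
have iP : (0 < Ordinal i_lt) && ~~ odd (Ordinal i_lt) by rewrite /=; lia.
by exists (Sub (Ordinal i_lt) iP); rewrite /half_label /label /= mul2n doubleK.
Qed.

Lemma Gadj_half (n : nat) (x y : Gvertex n) :
  half_adj (half_label x) (half_label y) -> Gadj 3 x y.
Proof.
rewrite /Gadj -(inj_eq (@half_label_inj n)) !admissible3E !labelE /half_adj.
lia.
Qed.

(** The range condition makes every entry the half-label of a vertex, so walks on integers transfer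
    to the graph. *)
Lemma lift_walk (n : nat) (w : seq nat) (x : Gvertex n) :
  all (fun k => 0 < k <= n) w -> path half_adj (half_label x) w ->
  exists w' : seq (G 3 n), path (@adj (G 3 n)) x w' /\ map (@half_label n) w' = w.
Proof.
elim: w x => [|i w IHw] x /=; first by exists [::].
case/andP=> /half_label_surj[y <-] wn /andP[xy yw].
have [w' [yw' <-]] := IHw y wn yw.
by exists (y :: w'); split=> //=; rewrite yw' andbT; apply: Gadj_half.
Qed.

Lemma G3_walk (n : nat) (x y : G 3 n) :
  exists w : seq (G 3 n), [/\ size w <= 3, path (@adj (G 3 n)) x w & last x w = y].
Proof.
have [w [sw wn xw wy]] :=
  short_walk_total (half_label_range x) (half_label_range y).
have [w' [xw' w'E]] := lift_walk wn xw; exists w'; split=> //.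
- by rewrite -(size_map (@half_label n)) w'E.
- by apply: (@half_label_inj n); rewrite -last_map w'E.
Qed.

Lemma dist_le_walk (H : sgraph) (x : H) (w : seq H) :
  path (@adj H) x w -> dist x (last x w) <= size w.
Proof.
move=> xw; rewrite /dist; set P := fun k => _; set s := iota _ _.
(* [dist] searches only lengths below [#|H|]. For a longer walk the default value [#|H|] already
   meets the bound; otherwise index [size w] is a hit of the search. *)
have [card_le|card_gt] := leqP #|H| (size w).
  by apply: leq_trans (find_size P s) _; rewrite size_iota.
rewrite leqNgt; apply/negP => /(before_find 0).
rewrite nth_iota // add0n => /negbT/negP; apply.
by rewrite /P; apply/existsP; exists (in_tuple w); rewrite /= xw eqxx.
Qed.

Theorem theorem4p1 (n : nat) (hn : 0 < n) :
  connected (G 3 n) /\ diameter (G 3 n) <= 3.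
Proof.
split; last first.
  apply/bigmax_leqP => x _; apply/bigmax_leqP => y _.
  have [w [sw xw <-]] := G3_walk x y.
  exact: leq_trans (dist_le_walk xw) sw.
split=> [|x y].
  by have [x _] := @half_label_surj n 1 hn; apply/card_gt0P; exists x.
by have [w [_ xw <-]] := G3_walk x y; apply/connectP; exists w.
Qed.
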